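(* Let $M\ge1$ be an integer and $(S^{(t)})_{t}$ positive integers. Consider the box–ball system with $M$ kinds of balls and carrier capacity $S^{(t)}$ at time $t$ (defined in the context), and fix a time $t$ at which the state has $N\ge1$ blocks of balls. For $k=1,\dots,M$ and $n=0,\dots,N-1$ let $Q^{(k,t)}_n$ be the number of balls with index $k$ in the $n$th block at time $t$, and for $n=0,\dots,N-2$ let $E^{(1,t)}_n$ be the number of empty boxes between the $n$th and $(n+1)$st blocks at time $t$; set $E^{(1,t)}_{N-1}:=+\infty$ and $Q^{(k,t)}_N:=0$. Define, for $n=0,\dots,N-1$, quantities $D^{(k)}_n$ ($k=1,\dots,M$), $\tilde E^{(k)}_n$ ($k=1,\dots,M+1$), $F_n$ and numbers $Q^{(k,t+1)}_n$, $E^{(1,t+1)}_n$ by the recursion \begin{gather*} D^{(k)}_0=Q^{(k,t)}_0,\quad F_0=E^{(1,t)}_0+\max\Big(0,S^{(t)}-\sum_{k=1}^MQ^{(k,t)}_0\Big),\quad \tilde E^{(1)}_0=E^{(1,t)}_0+\max\Big(0,\sum_{k=1}^MQ^{(k,t)}_0-S^{(t)}\Big),\\ Q^{(k,t+1)}_n=\min(D^{(k)}_n,\tilde E^{(k)}_n),\quad \tilde E^{(k+1)}_n=\tilde E^{(k)}_n-Q^{(k,t+1)}_n+Q^{(k,t)}_{n+1}\quad(k=1,\dots,M),\\ E^{(1,t+1)}_n=\min(F_n,\tilde E^{(M+1)}_n),\\ D^{(k)}_{n+1}=D^{(k)}_n-Q^{(k,t+1)}_n+Q^{(k,t)}_{n+1},\quad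 F_{n+1}=F_n-E^{(1,t+1)}_n+E^{(1,t)}_{n+1},\quad \tilde E^{(1)}_{n+1}=\tilde E^{(M+1)}_n-E^{(1,t+1)}_n+E^{(1,t)}_{n+1} \end{gather*} (the last line for $n\le N-2$). Then the state at time $t+1$ has $N$ blocks, and for $k=1,\dots,M$, $n=0,\dots,N-1$, the number of balls with index $k$ in its $n$th block equals $Q^{(k,t+1)}_n$, and for $n=0,\dots,N-2$ the number of empty boxes between its $n$th and $(n+1)$st blocks equals $E^{(1,t+1)}_n$. That is, $Q^{(k,t)}_n$ and $E^{(1,t)}_n$ satisfy the nonautonomous ultradiscrete hungry Toda lattice with the finite lattice condition $E^{(1,t)}_{N-1}=\tilde E^{(1)}_{N-1}=+\infty$.
   Context: Box–ball system: boxes are indexed by $n\in\mathbb Z$; each box contains either nothing or one ball with an index in $\{1,\dots,M\}$. Write $U^{(k,t)}_n\in\{0,1\}$ ($k=0,1,\dots,M$) for the number of balls of index $k$ in box $n$ at time $t$, where index $0$ means ''empty space'', so $\sum_{k=0}^MU^{(k,t)}_n=1$; only finitely many boxes are nonempty. Indices $k$ are taken modulo $M+1$. The state at time $t+1$ is obtained as follows: define $V^{(k,t)}_n$ (contents of the carrier at box $n$) by $V^{(0,t)}_n=S^{(t)}$, $V^{(k,t)}_n=0$ ($k=1,\dots,M$) for $n\ll0$, and \[ X^{(k,t)}_n=\min_{i=0,1,\dots,M}\Big(\sum_{j=0}^{M-i-1}U^{(k+j,t)}_n+\sum_{j=M-i+1}^{M}V^{(k+j,t)}_n\Big),\quad V^{(k,t)}_{n+1}=V^{(k,t)}_n+X^{(k,t)}_n-X^{(k+1,t)}_n,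 \] \[ U^{(k,t+1)}_n=U^{(k,t)}_n-X^{(k,t)}_n+X^{(k+1,t)}_n . \] Blocks: the nonempty boxes at a given time are partitioned into blocks, each being a maximal run of consecutive nonempty boxes whose ball indices are weakly increasing from left to right (e.g. the configuration 1222333112 consists of the two blocks 1222333 and 112). Blocks are numbered $0,1,\dots,N-1$ from left to right. Arithmetic with $+\infty$: $a+\infty=+\infty$, $\min(a,+\infty)=a$, $(+\infty)-a=+\infty$ for finite $a$. *)

(* Defs.v *)
From mathcomp Require Import all_boot all_order all_algebra.
Set Implicit Arguments. Unset Strict Implicit. Unset Printing Implicit Defensive.
Import Order.TTheory GRing.Theory Num.Theory.
Local Open Scope ring_scope.

Inductive xint := XFin of int | XInf.

Definition xadd (x y : xint) : xint :=
  match x, y with XFin a, XFin b => XFin (a + b) | _, _ => XInf end.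
(* oo - a = oo for finite a; (_ - oo) is never used (junk value oo) *)
Definition xsub (x y : xint) : xint :=
  match x, y with XFin a, XFin b => XFin (a - b) | _, _ => XInf end.
Definition xmin (x y : xint) : xint :=
  match x, y with
  | XFin a, XFin b => XFin (Num.min a b)
  | XInf, _ => y
  | _, XInf => x
  end.

(* Box-ball system.  A state is b : int -> nat, b n = index of the     *)
(* ball in box n (0 = empty).  Carrier indices k are read mod M+1.     *)

Definition occ (M : nat) (b : int -> nat) (n : int) (k : nat) : int :=
  ((b n == k %% M.+1)%N : nat)%:Z.

Definition Xc (M : nat) (U V : nat -> int) (k : nat) : int :=
  let A := fun i : nat =>
    \sum_(0 <= j < M - i) U ((k + j) %% M.+1)%N
    + \sum_(M - i + 1 <= j < M.+1) V ((k + j) %% M.+1)%N in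
  foldr (fun i acc => Num.min (A i) acc) (A M) (iota 0 M).

(* carrier contents V_{n0+m} = [:: V^{(0)}; ...; V^{(M)}], starting from
   V_{n0} = (S,0,...,0); V^{(k)} for arbitrary k is read at k mod M+1 *)
Fixpoint carrier (M S : nat) (b : int -> nat) (n0 : int) (m : nat) : seq int :=
  match m with
  | 0 => [seq (if k == 0%N then S%:Z else 0) | k <- iota 0 M.+1]
  | m'.+1 =>
      let Vs := carrier M S b n0 m' in
      let V := fun k => nth 0 Vs k in
      let U := occ M b (n0 + m'%:Z) in
      [seq V k + Xc M U V k - Xc M U V k.+1 | k <- iota 0 M.+1]
  end.

(* U^{(k,t+1)}_n, computed with the carrier entering from n0 (all boxes
   left of n0 empty; there the carrier is stationary and boxes stay empty) *)
Definition bbs_next (M S : nat) (b : int -> nat) (n0 : int) : int -> nat -> int :=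
  fun n k =>
    if n < n0 then occ M b n k
    else
      let V := fun k => nth 0 (carrier M S b n0 (absz (n - n0))) k in
      let U := occ M b n in
      U k - Xc M U V k + Xc M U V k.+1.

(* Blocks: block i occupies boxes a i .. c i (i < N), numbered left to *)
(* right; each is a maximal run of consecutive nonempty boxes with     *)
(* weakly increasing ball indices.                                     *)
Definition is_blocks (b : int -> nat) (N : nat) (a c : nat -> int) : Prop :=
  (forall i, (i < N)%N -> a i <= c i) /\
  (forall i, (i.+1 < N)%N -> c i < a i.+1) /\
  (forall i n, (i < N)%N -> a i <= n <= c i -> b n <> 0%N) /\
  (forall i n, (i < N)%N -> a i <= n < c i -> leq (b n) (b (n + 1))) /\
  (forall n, b n <> 0%N -> exists2 i, (i < N)%N & a i <= n <= c i) /\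
  (forall i, (i < N)%N -> (b (a i - 1) == 0%N) || ltn (b (a i)) (b (a i - 1))) /\
  (forall i, (i < N)%N -> (b (c i + 1) == 0%N) || ltn (b (c i + 1)) (b (c i))).

Definition blk_count (b : int -> nat) (k : nat) (lo hi : int) : nat :=
  (\sum_(0 <= i < (absz (hi - lo)).+1) nat_of_bool (b (lo + i%:Z)%R == k))%N.

(* Etil ... n j = \tilde E^{(j+1)}_n, given D^{(.)}_n and \tilde E^{(1)}_n *)
Fixpoint Etil (Q : nat -> nat -> int) (D : nat -> xint) (e1 : xint) (n j : nat)
  : xint :=
  match j with
  | 0 => e1
  | j'.+1 =>
      let e := Etil Q D e1 n j' in
      xadd (xsub e (xmin (D j'.+1) e)) (XFin (Q j'.+1 n.+1))
  end.

Fixpoint udhT_state (M S : nat) (Q : nat -> nat -> int) (E : nat -> xint) (n : nat)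
  : (nat -> xint) * xint * xint :=
  match n with
  | 0 =>
      let s0 := \sum_(1 <= k < M.+1) Q k 0%N in
      (fun k => XFin (Q k 0%N),
       xadd (E 0%N) (XFin (Num.max 0 (S%:Z - s0))),
       xadd (E 0%N) (XFin (Num.max 0 (s0 - S%:Z))))
  | n'.+1 =>
      let '(D, F, e1) := udhT_state M S Q E n' in
      let Et := Etil Q D e1 n' in
      let Qn := fun k => xmin (D k) (Et k.-1) in
      let En := xmin F (Et M) in
      (fun k => xadd (xsub (D k) (Qn k)) (XFin (Q k n'.+1)),
       xadd (xsub F En) (E n'.+1),
       xadd (xsub (Et M) En) (E n'.+1))
  end.

Definition udhT_Q (M S : nat) (Q : nat -> nat -> int) (E : nat -> xint) (k n : nat)
  : xint :=
  let '(D, F, e1) := udhT_state M S Q E n in xmin (D k) (Etil Q D e1 n k.-1).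

Definition udhT_E (M S : nat) (Q : nat -> nat -> int) (E : nat -> xint) (n : nat)
  : xint :=
  let '(D, F, e1) := udhT_state M S Q E n in xmin F (Etil Q D e1 n M).

(* Main.v *)
(* Read the kinds [0, ..., M] cyclically, the empty box being kind [0].  The carrier exchanges the
   content [u] of a box for the first kind after [u] in cyclic order (with [u] itself last) that it
   holds.  A state is a sequence of runs [0, 1, 2, ...], run [l] consisting of boxes of kind
   [l mod M+1], and balls and gaps play the same role.  Let [P l] and [X l] be the starting positions
   of run [l] before and after the time step.  Output run [j] goes on until the kind [j] is exhausted
   (its supply at [X j], in the carrier and in the rest of input run [j], is [D j]) or until the next
   input run of its kind starts, at [P (j+M+1)]; hence its length is [min (D j) (T j)] with
   [T j = P (j+M+1) - X j].  Conservation of each kind gives the recursion of the Toda lattice for [D]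
   and [T].  That the runs form blocks means that among any [M] consecutive runs one is nonempty, and
   this property is inherited by the output. *)

Require Import Defs.
From mathcomp Require Import all_boot all_order all_algebra zify.
Import Order.TTheory GRing.Theory Num.Theory.
Local Open Scope ring_scope.

(** * The min formula as an exchange of single balls *)

Definition emit (M : nat) (V : nat -> nat) (u : nat) : nat :=
  ((u + (find (fun d => 0 < V ((u + d) %% M.+1)) (iota 1 M.+1)).+1) %% M.+1)%N.

(** Carrier contents as natural numbers, boxes being counted from where the carrier enters. For
    positive [S] and kinds at most [M] the truncated subtraction is exact, because the emitted kind
    is held ([load_emitted_gt0]). *)
Fixpoint load (M S : nat) (f : nat -> nat) (x : nat) : nat -> nat :=
  match x with
  | 0 => fun k => if k == 0%N then S else 0%N
  | x'.+1 => fun k =>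
      (load M S f x' k + (k == f x') - (k == emit M (load M S f x') (f x')))%N
  end.

Lemma modn_window_inj (p l l' : nat) :
  (l <= l' < l + p)%N -> (l = l' %[mod p])%N -> l = l'.
Proof.
case/andP=> le_ll' lt_l'; have -> : l' = (l + (l' - l))%N by lia.
move/eqP; rewrite -[X in (X == _ %[mod _])%N]addn0 eqn_modDl mod0n.
by rewrite modn_small; lia.
Qed.

(** Cyclic distances are taken in [1, p], not [0, p-1]: a kind is at distance [p] from itself, being
    the last one that [emit] tries. *)
Lemma modn_addl_dist (p u v : nat) :
  (0 < p)%N -> exists2 d, (0 < d <= p)%N & (u + d = v %[mod p])%N.
Proof.
move=> p_gt0; exists (p - (u + (p - v %% p)) %% p)%N.
  have : ((u + (p - v %% p)) %% p < p)%N by rewrite ltn_mod.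
  by lia.
set w := (u + (p - v %% p))%N.
have ltw : (w %% p < p)%N by rewrite ltn_mod.
have ltv : (v %% p < p)%N by rewrite ltn_mod.
have -> : (u + (p - w %% p))%N = ((w - w %% p) + v %% p)%N.
  by have := leq_mod w p; rewrite /w in ltw *; lia.
by rewrite {1}(divn_eq w p) addnK modnMDl modn_mod.
Qed.

Lemma emit_exists (M : nat) (V : nat -> nat) (u : nat) :
  (exists2 k, k <= M & 0 < V k)%N ->
  exists d, [/\ (0 < d <= M.+1)%N, emit M V u = ((u + d) %% M.+1)%N,
    (0 < V ((u + d) %% M.+1))%N &
    forall e, (0 < e < d)%N -> V ((u + e) %% M.+1)%N = 0%N].
Proof.
move=> [k leM Vk]; set a := fun d => (0 < V ((u + d) %% M.+1))%N.
have hasa : has a (iota 1 M.+1).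
  have [d d_bd eqd] := modn_addl_dist M.+1 u k (ltn0Sn M).
  apply/hasP; exists d; first by rewrite mem_iota; lia.
  by rewrite /a eqd modn_small.
exists (find a (iota 1 M.+1)).+1.
have ltf : (find a (iota 1 M.+1) < M.+1)%N by move: hasa; rewrite has_find size_iota.
split=> //; first by have := nth_find 0%N hasa; rewrite nth_iota.
move=> e /andP[e0 lte]; apply/eqP; rewrite -leqn0 leqNgt.
have := @before_find _ 0%N a (iota 1 M.+1) e.-1; rewrite nth_iota; last by lia.
by rewrite add1n prednK // => H; apply/negbT/H; lia.
Qed.

Lemma emit_eq (M : nat) (V : nat -> nat) (u d : nat) :
  (0 < d <= M.+1)%N -> (0 < V ((u + d) %% M.+1))%N ->
  (forall e, (0 < e < d)%N -> V ((u + e) %% M.+1)%N = 0%N) ->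
  emit M V u = ((u + d) %% M.+1)%N.
Proof.
move=> d_bd Vd Ve.
have [|d' [d'_bd -> Vd' Ve']] := @emit_exists M V u.
  by exists ((u + d) %% M.+1)%N => //; rewrite -ltnS ltn_mod.
congr ((u + _) %% _)%N; case: (ltngtP d d') => // ltd.
  by move: Vd; rewrite Ve' //; lia.
by move: Vd'; rewrite Ve //; lia.
Qed.

Lemma foldr_min_eq (A : nat -> int) (M i0 : nat) (z : int) :
  (i0 <= M)%N -> A i0 = z -> (forall i, (i <= M)%N -> z <= A i) ->
  foldr (fun i acc => Num.min (A i) acc) (A M) (iota 0 M) = z.
Proof.
move=> lei0 Ai0 leA; set s := iota 0 M.
have lez : forall t, {subset t <= s} -> 
    z <= foldr (fun i acc => Num.min (A i) acc) (A M) t.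
  elim=> [|i t IHt] sub /=; first exact: leA.
  rewrite le_min IHt ?andbT; last by move=> y yt; apply: sub; rewrite inE yt orbT.
  by apply: leA; have := sub i (mem_head _ _); rewrite mem_iota; lia.
apply/eqP; rewrite eq_le lez // andbT -Ai0.
(* [iota 0 M] stops at [M-1]; the case [i0 = M] is served by the seed [A M] of the fold. *)
have [i0s|] := boolP (i0 \in s); last first.
  rewrite mem_iota => ni; have -> : i0 = M by lia.
  elim: {lez ni}s => //= i t IHt.
  by rewrite ge_min IHt orbT.
elim: s i0s {lez} => //= i t IHt; rewrite inE ge_min => /orP[/eqP->|/IHt->].
  by rewrite lexx.
by rewrite orbT.
Qed.

(* [X^{(k)}] is [0] if the kinds [u+1, ..., k-1] are all absent from the carrier (the minimum is
   reached at [i = e-1]) and [1] otherwise. *)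
Lemma Xc_emit (M u d k e : nat) (U : nat -> int) (V : nat -> int) (W : nat -> nat) :
  (u <= M)%N ->
  (forall k, (k <= M)%N -> U k = ((u == k)%N : nat)%:Z) ->
  (forall k, (k <= M)%N -> V k = (W k)%:Z) ->
  (0 < d <= M.+1)%N -> (0 < W ((u + d) %% M.+1))%N ->
  (forall e, (0 < e < d)%N -> W ((u + e) %% M.+1)%N = 0%N) ->
  (0 < e <= M.+1)%N -> (u + e = k %[mod M.+1])%N ->
  Xc M U V k = ((d < e)%N : nat)%:Z.
Proof.
move=> leu HU HV d_bd Wd We e_bd eqk.
have lemod z : (z %% M.+1 <= M)%N by rewrite -ltnS ltn_mod.
have kj j : ((k + j) %% M.+1 = (u + (e + j)) %% M.+1)%N.
  by rewrite addnA -modnDml -eqk modnDml.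
have Uj j : (j < M)%N -> U ((k + j) %% M.+1)%N = ((e + j == M.+1)%N : nat)%:Z.
  move=> ltj; rewrite HU // kj; congr ((nat_of_bool _)%:Z).
  apply/eqP/eqP => [equ|->]; last by rewrite modnDr modn_small.
  case: (leqP (e + j) M) => [le|gt].
    have : u = (u + (e + j))%N by apply: (modn_window_inj M.+1); [lia|rewrite -equ modn_small].
    by lia.
  have : (M.+1 = e + j)%N.
    apply: (modn_window_inj M.+1); first by lia.
    by apply/eqP; rewrite -(eqn_modDl u) modnDr -equ modn_small.
  by lia.
have Vj j : V ((k + j) %% M.+1)%N = (W ((u + (e + j)) %% M.+1)%N)%:Z by rewrite HV // kj.
pose A i : int := \sum_(0 <= j < M - i) U ((k + j) %% M.+1)%N
  + \sum_(M - i + 1 <= j < M.+1) V ((k + j) %% M.+1)%N.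
rewrite -[LHS]/(foldr (fun i acc => Num.min (A i) acc) (A M) (iota 0 M)).
(* The box part of [A i] covers the distances e, ..., e+M-i-1 from [u]; it meets [u] itself, at
   distance M+1, exactly when i+1 < e. *)
have AE i : (i <= M)%N -> A i = ((i.+1 < e)%N : nat)%:Z +
    \sum_(M - i + 1 <= j < M.+1) (W ((u + (e + j)) %% M.+1)%N)%:Z.
  move=> lei; rewrite /A; congr (_ + _); last by apply: eq_bigr => j _.
  rewrite (eq_big_nat _ _ (F2 := fun j => ((e + j == M.+1)%N : nat)%:Z)); last first.
    by move=> j /andP[_ ltj]; apply: Uj; lia.
  case: (ltnP i.+1 e) => [lt|ge]; last first.
    by rewrite big_nat big1 // => j bj; case: eqP => //; lia.
  have ltj : (M.+1 - e < M - i)%N by lia.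
  rewrite big_mkord (bigD1 (Ordinal ltj)) //= subnKC ?eqxx; last by lia.
  by rewrite big1 ?addr0 // => j; rewrite -val_eqE /=; case: eqP => //; lia.
case: (ltnP d e) => [ltde|leed].
  apply: (@foldr_min_eq A M 0%N) => //.
    rewrite AE // subn0 addn1 big_geq // addr0.
    by have -> : (1 < e)%N by lia.
  move=> i lei; rewrite AE //.
  case: (ltnP i.+1 e) => [lt|ge].
    by rewrite lerDl sumr_ge0.
  (* Here the box part vanishes, but the carrier part contains, at j = M+1+d-e, the kind at distance
     [d], which is held and contributes at least 1. *)
  have hj : (M - i + 1 <= M.+1 + d - e < M.+1)%N by lia.
  rewrite (big_cat_nat (n := (M.+1 + d - e)%N)) /=; try lia.
  rewrite [X in _ + (_ + X)]big_ltn; last by lia.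
  have -> : (u + (e + (M.+1 + d - e)) = (u + d) + M.+1)%N by lia.
  rewrite modnDr add0r.
  have sum_ge0 r : 0 <= \sum_(j <- r) (W ((u + (e + j)) %% M.+1)%N)%:Z by exact: sumr_ge0.
  apply: (@le_trans _ _ (W ((u + d) %% M.+1)%N)%:Z); first exact: Wd.
  by rewrite addrCA lerDl addr_ge0.
apply: (@foldr_min_eq A M e.-1%N) => //; first by lia.
  rewrite AE; last by lia.
  have -> : (e.-1.+1 < e)%N = false by lia.
  rewrite add0r big_nat big1 // => j bj.
  have -> : (u + (e + j) = (u + (e + j - M.+1)) + M.+1)%N by lia.
  by rewrite modnDr We //; lia.
by move=> i lei; rewrite AE // addr_ge0 // sumr_ge0.
Qed.

Definition emitted (M S : nat) (f : nat -> nat) (x : nat) : nat :=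
  emit M (load M S f x) (f x).

(** After an exchange the carrier still holds the kind just picked up: if that same kind was
    emitted, the carrier already held it before. *)
Lemma load_gt0 (M S : nat) (f : nat -> nat) :
  (0 < S)%N -> (forall x, (f x <= M)%N) ->
  forall x, exists2 k, (k <= M)%N & (0 < load M S f x k)%N.
Proof.
move=> S_gt0 lef; elim=> [|x IHx]; first by exists 0%N.
exists (f x) => //=; rewrite eqxx.
have [d [_ eo Vo _]] := @emit_exists M (load M S f x) (f x) IHx.
by case: eqP => [->|_]; [rewrite eo|]; lia.
Qed.

Lemma load_emitted_gt0 (M S : nat) (f : nat -> nat) (x : nat) :
  (0 < S)%N -> (forall x, (f x <= M)%N) ->
  (0 < load M S f x (emitted M S f x))%N.
Proof.
move=> S_gt0 lef; rewrite /emitted.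
by have [d [_ -> ? _]] := @emit_exists M _ (f x) (@load_gt0 M S f S_gt0 lef x).
Qed.

Lemma emitted_le (M S : nat) (f : nat -> nat) (x : nat) : (emitted M S f x <= M)%N.
Proof. by rewrite -ltnS ltn_mod. Qed.

Lemma loadS (M S : nat) (f : nat -> nat) (x k : nat) :
  (0 < S)%N -> (forall x, (f x <= M)%N) ->
  (load M S f x.+1 k + (k == emitted M S f x) = load M S f x k + (k == f x))%N.
Proof.
move=> S_gt0 lef /=; rewrite -/(emitted M S f x).
have := @load_emitted_gt0 M S f x S_gt0 lef.
by case: (k =P emitted M S f x) => [<-|_]; lia.
Qed.

Lemma loadS_gt0 (M S : nat) (f : nat -> nat) (x : nat) :
  (0 < S)%N -> (forall x, (f x <= M)%N) -> (0 < load M S f x.+1 (f x))%N.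
Proof.
move=> S_gt0 lef; have := @loadS M S f x (f x) S_gt0 lef; rewrite eqxx.
have := @load_emitted_gt0 M S f x S_gt0 lef.
by case: eqP => [<-|_]; lia.
Qed.

Lemma occ_small (M : nat) (b : int -> nat) (n : int) (k : nat) :
  (k <= M)%N -> occ M b n k = ((b n == k)%N : nat)%:Z.
Proof. by move=> lek; rewrite /occ modn_small. Qed.

(** With [d] and [e] the distances from [u] to the emitted kind and to [k], the difference is
    [d < e] - [d < e+1] = -[d = e]. The exception is e = M+1, that is k = u: then k+1 is at distance
    1, and the difference is [d < M+1] = 1 - [d = M+1]. *)
Lemma Xc_diff (M : nat) (U V : nat -> int) (W : nat -> nat) (u k : nat) :
  (u <= M)%N ->
  (forall k, (k <= M)%N -> U k = ((u == k)%N : nat)%:Z) ->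
  (forall k, (k <= M)%N -> V k = (W k)%:Z) ->
  (exists2 k, k <= M & 0 < W k)%N -> (k <= M)%N ->
  Xc M U V k - Xc M U V k.+1 = ((u == k) : nat)%:Z - ((emit M W u == k) : nat)%:Z.
Proof.
move=> leu HU HV W_gt0 lek.
have [d [d_bd eo Wd We]] := @emit_exists M W u W_gt0.
have [e e_bd eqk] := modn_addl_dist M.+1 u k (ltn0Sn M).
rewrite (@Xc_emit M u d k e U V W) //.
have -> : (emit M W u == k) = (d == e).
  rewrite eo; apply/eqP/eqP => [eq_k|->]; last by rewrite eqk modn_small.
  have eq_de : (d = e %[mod M.+1])%N.
    by apply/eqP; rewrite -(eqn_modDl u) eq_k eqk modn_small.
  by case: (ltngtP d e) => // ?; [|symmetry];
    apply: (modn_window_inj M.+1) => //; lia.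
have -> : (u == k) = (e == M.+1).
  apply/eqP/eqP => [eq_uk|eqe]; last first.
    by move: eqk; rewrite eqe modnDr !modn_small.
  apply: (modn_window_inj M.+1); first by lia.
  by apply/eqP; rewrite -(eqn_modDl u) eqk modnDr eq_uk.
have [eqe|neqe] := eqVneq e M.+1.
  rewrite (@Xc_emit M u d k.+1 1%N U V W) //; last first.
    by rewrite addn1 -addn1 -[in RHS]addn1 -[in RHS]modnDml -eqk eqe modnDr modnDml.
  by rewrite eqe; case: (ltngtP d M.+1) => ?; lia.
rewrite (@Xc_emit M u d k.+1 e.+1 U V W) //; first by case: (ltngtP d e) => ?; lia.
  by lia.
by rewrite addnS -addn1 -[in RHS]addn1 -[in RHS]modnDml -eqk modnDml.
Qed.

Lemma carrier_load (M S : nat) (b : int -> nat) (n0 : int) (x k : nat) :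
  (0 < S)%N -> (forall n, (b n <= M)%N) -> (k <= M)%N ->
  nth 0 (carrier M S b n0 x) k =
    (load M S (fun y => b (n0 + y%:Z)) x k)%:Z.
Proof.
move=> S_gt0 leb; elim: x k => [|x IHx] k lek.
  by rewrite (nth_map 0%N) ?size_iota // nth_iota //=; case: k lek.
set V := fun k => nth 0 (carrier M S b n0 x) k.
set U := occ M b (n0 + x%:Z).
rewrite -[carrier M S b n0 x.+1]/[seq V k + Xc M U V k - Xc M U V k.+1 | k <- iota 0 M.+1].
rewrite (nth_map 0%N) ?size_iota // nth_iota // add0n.
rewrite -addrA (@Xc_diff M _ _ (load M S (fun y => b (n0 + y%:Z)) x) (b (n0 + x%:Z))) //.
- rewrite /V IHx //.
  have := @loadS M S (fun y => b (n0 + y%:Z)) x k S_gt0 (fun y => leb _).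
  by rewrite /emitted [k == _]eq_sym [k == b _]eq_sym; lia.
- by move=> ? ?; rewrite /U occ_small.
- exact: load_gt0.
Qed.

Lemma bbs_next_emitted (M S : nat) (b : int -> nat) (n0 : int) (x k : nat) :
  (0 < S)%N -> (forall n, (b n <= M)%N) -> (k <= M)%N ->
  bbs_next M S b n0 (n0 + x%:Z) k =
    ((emitted M S (fun y => b (n0 + y%:Z)) x == k) : nat)%:Z.
Proof.
move=> S_gt0 leb lek; rewrite /bbs_next.
have -> : (n0 + x%:Z < n0) = false by lia.
have -> : absz (n0 + x%:Z - n0)%R = x by lia.
cbv zeta; set V := fun k => _; set U := occ M b _.
have H : Xc M U V k - Xc M U V k.+1 = ((b (n0 + x%:Z) == k) : nat)%:Z
    - ((emitted M S (fun y => b (n0 + y%:Z)) x == k) : nat)%:Z.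
  apply: Xc_diff => //.
  - by move=> ? ?; rewrite /U occ_small.
  - by move=> ? ?; rewrite /V carrier_load.
  - exact: load_gt0.
by rewrite -addrA [- _ + _]addrC -opprB H /U occ_small // opprB addrC subrK.
Qed.

(** * Output runs and conservation of the supply of each kind *)

Lemma exists_run (P : nat -> nat) (x n : nat) :
  P 0 = 0%N -> (x < P n)%N -> exists2 i, (i < n)%N & (P i <= x < P i.+1)%N.
Proof.
move=> P0; elim: n => [|n IHn] ltx; first by rewrite P0 in ltx.
case: (ltnP x (P n)) => [/IHn[i ltin bx]|le]; first by exists i => //; lia.
by exists n => //; rewrite le.
Qed.

Lemma run_ge (P : nat -> nat) (i j x : nat) :
  (forall i j, (i <= j)%N -> (P i <= P j)%N) ->
  (P j <= x)%N -> (P i <= x < P i.+1)%N -> (j <= i)%N.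
Proof. by move=> P_mono lex bx; rewrite leqNgt; apply/negP => /P_mono; lia. Qed.

Lemma mod_neq (M i l : nat) :
  (i < l < i + M.+1)%N -> (l %% M.+1 == i %% M.+1)%N = false.
Proof.
move=> bl; apply/negP => /eqP eqil.
by have := modn_window_inj M.+1 i l; lia.
Qed.

Section Runs.

Local Open Scope nat_scope.

Variables (M S : nat) (f P : nat -> nat).
Hypotheses (S_gt0 : (0 < S)%N) (f_le : forall x, (f x <= M)%N).
Hypothesis P0 : P 0 = 0%N.
Hypothesis P_mono : forall i j, (i <= j)%N -> (P i <= P j)%N.
Hypothesis f_run : forall i x, (P i <= x < P i.+1)%N -> f x = (i %% M.+1)%N.

Let W := load M S f.
Let o := emitted M S f.

(** The two arguments of [minn] are the supply and the distance to the next input run of the same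
    kind. No output run starts before the input run of its index, so the unread part of that run is
    [P j'.+1 - x]. *)
Fixpoint out_pos (j : nat) : nat :=
  match j with
  | 0 => 0%N
  | j'.+1 =>
      let x := out_pos j' in
      (x + minn (load M S f x (j' %% M.+1) + (P j'.+1 - x)) (P (j' + M.+1) - x))%N
  end.

(* Kinds are read modulo [M+1], so the second clause says that the carrier holds no kind
   [i+1, ..., j+M] when box [x] lies in input run [i]: with [i-M, ..., i] as representatives, the
   first kind it may hold is [j]. *)
Definition writing (x j : nat) : Prop :=
  (P j <= x <= P (j + M.+1))%N /\
  forall l, (l <= j + M)%N -> (x < P l)%N -> W x (l %% M.+1)%N = 0%N.

(** The carrier is never empty, and before [P j.+1] the exclusions of [writing] rule out every kind
    but that of [j]. *)
Lemma writing_gt0 (x j : nat) :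
  writing x j -> (x < P j.+1)%N -> (0 < W x (j %% M.+1))%N.
Proof.
move=> [bx Wx0] ltx; have [k lek Wk] := load_gt0 M S f S_gt0 f_le x.
rewrite -/W in Wk.
have [d d_bd eqd] := modn_addl_dist M.+1 j k (ltn0Sn M).
have [eqdM|ned] := eqVneq d M.+1.
  by move: eqd; rewrite eqdM modnDr (@modn_small k M.+1 lek) => ->.
move: Wk; rewrite -(@modn_small k M.+1 lek) -eqd Wx0 //; first by lia.
by apply: leq_trans ltx _; apply: P_mono; lia.
Qed.

(** Box [x] lies in some input run [i] with j <= i <= j+M. The kinds of i+1, ..., j+M come next in
    cyclic order and are absent; the kind after them is that of j+M+1, hence of [j]. *)
Lemma writing_emit (x j : nat) :
  writing x j -> (x < P (j + M.+1))%N -> (0 < W x (j %% M.+1))%N ->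
  o x = (j %% M.+1)%N.
Proof.
move=> [bx Wx0] ltx Wj.
have [i lti bi] := exists_run P _ _ P0 ltx.
have leji : (j <= i)%N by apply: (run_ge P i j x P_mono); lia.
rewrite /o /emitted (f_run i) //.
have eqd : (i %% M.+1 + (j + M.+1 - i) = j %[mod M.+1])%N.
  by rewrite modnDml subnKC ?modnDr //; lia.
rewrite -eqd; apply: emit_eq; first by lia.
  by rewrite eqd.
move=> e be; rewrite modnDml; apply: Wx0; first by lia.
by apply: (@leq_trans (P i.+1)); [lia|apply: P_mono; lia].
Qed.

(** The kind picked up is that of the current input run, which is not among the excluded later
    ones. *)
Lemma writing_step (x j : nat) :
  writing x j -> (x < P (j + M.+1))%N -> (0 < W x (j %% M.+1))%N ->
  writing x.+1 j.
Proof.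
move=> wx ltx Wj; have ox := writing_emit _ _ wx ltx Wj.
case: (wx) => bx Wx0; split; first by lia.
move=> l lel ltl.
have [i lti bi] := exists_run P _ _ P0 ltx.
have leji : (j <= i)%N by apply: (run_ge P i j x P_mono); lia.
have ltil : (i < l)%N.
  by rewrite ltnNge; apply/negP => /P_mono; lia.
have := loadS M S f x (l %% M.+1) S_gt0 f_le.
rewrite -/W (f_run i) // mod_neq; last by lia.
by rewrite Wx0 //; lia.
Qed.

(** The only new exclusion concerns l = j+M+1, which has the kind of [j]: either that kind is
    exhausted or its input run has already been reached. *)
Lemma writing_next (x j : nat) :
  writing x j -> (x = P (j + M.+1)) \/ (W x (j %% M.+1) = 0)%N ->
  writing x j.+1.
Proof.
move=> wx stop; have [bx Wx0] := wx.
have lejx : (P j.+1 <= x)%N.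
  rewrite leqNgt; apply/negP => ltx; case: stop => [eqx|W0].
    by have := @P_mono j.+1 (j + M.+1)%N; lia.
  by have := writing_gt0 _ _ wx ltx; rewrite W0.
split.
  by rewrite lejx; have := @P_mono (j + M.+1)%N (j.+1 + M.+1)%N; lia.
move=> l lel ltl; case: (leqP l (j + M)) => [le|gt]; first exact: Wx0.
have eql : l = (j + M.+1)%N by lia.
case: stop => [eqx|W0]; first by rewrite eql eqx ltnn in ltl.
by rewrite eql modnDr.
Qed.

(* The supply of kind [l] at [x]: the content of the carrier and the unread part of input run [l]. *)
Definition avail (x l : nat) : nat :=
  (W x (l %% M.+1) + (P l.+1 - x - (P l - x)))%N.

(** Reading a box only moves one item from the unread input into the carrier; the emission alone
    changes a supply. The range of [l] contains one run of each kind, including the run being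
    read. *)
Lemma avail_step (x j l : nat) :
  writing x j -> (x < P (j + M.+1))%N -> (0 < W x (j %% M.+1))%N ->
  (j <= l <= j + M)%N -> (avail x.+1 l + (l == j) = avail x l)%N.
Proof.
move=> wx ltx Wj bl; have ox := writing_emit _ _ wx ltx Wj.
have [i lti bi] := exists_run P _ _ P0 ltx.
have leji : (j <= i)%N by apply: (run_ge P i j x P_mono); case: wx; lia.
have := loadS M S f x (l %% M.+1) S_gt0 f_le.
rewrite -/W -/o ox (f_run i) // /avail.
have -> : (l %% M.+1 == j %% M.+1)%N = (l == j).
  by case: (eqVneq l j) => [->|ne]; rewrite ?eqxx ?mod_neq //; lia.
have P_l := @P_mono l l.+1 (leqnSn l).
case: (ltngtP l i) => [ltl|gtl|->].
- rewrite [l %% _ == _]eq_sym mod_neq; last by lia.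
  by have := @P_mono l.+1 i ltl; lia.
- rewrite mod_neq; last by lia.
  by have := @P_mono i.+1 l gtl; lia.
- by rewrite eqxx; lia.
Qed.

Lemma writing_run (x j s : nat) :
  writing x j -> (s <= minn (avail x j) (P (j + M.+1) - x))%N ->
  [/\ writing (x + s) j,
      forall l, (j < l <= j + M)%N -> avail (x + s) l = avail x l,
      (avail (x + s) j + s = avail x j)%N &
      forall y, (x <= y < x + s)%N -> o y = (j %% M.+1)%N].
Proof.
move=> wx; elim: s => [|s IHs] les.
  by rewrite addn0; split=> // [|y]; lia.
have [|ws al aj os] := IHs; first by lia.
have lts : (x + s < P (j + M.+1))%N by lia.
(* Past the end of input run [j] the remaining supply is all in the carrier, and it is positive
   because fewer than [avail x j] items have been emitted. *)
have Ws : (0 < W (x + s) (j %% M.+1))%N.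
  have [lt|ge] := ltnP (x + s) (P j.+1); first exact: writing_gt0 ws lt.
  by move: aj; rewrite {1}/avail; lia.
rewrite addnS; split.
- exact: writing_step.
- move=> l bl; rewrite -al //.
  have := @avail_step (x + s) j l ws lts Ws.
  by case: eqP => [eql|_]; lia.
- by have := @avail_step (x + s) j j ws lts Ws; rewrite eqxx; lia.
- move=> y by_; have [lty|gty] := ltnP y (x + s); first by apply: os; lia.
  have -> : y = (x + s)%N by lia.
  exact: writing_emit.
Qed.

Lemma avail_started (x l : nat) : (P l <= x)%N ->
  avail x l = (W x (l %% M.+1) + (P l.+1 - x))%N.
Proof. by rewrite /avail => lex; lia. Qed.

Lemma out_posS (j : nat) : writing (out_pos j) j ->
  out_pos j.+1 = (out_pos j + minn (avail (out_pos j) j) (P (j + M.+1) - out_pos j))%N.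
Proof. by case=> bx _; rewrite avail_started //; lia. Qed.

Lemma out_pos_stop (j : nat) : writing (out_pos j) j ->
  writing (out_pos j.+1) j /\
  ((out_pos j.+1 = P (j + M.+1)) \/ (W (out_pos j.+1) (j %% M.+1) = 0)%N).
Proof.
move=> wj; rewrite out_posS //.
have [ws _ aj _] := writing_run _ _ _ wj (leqnn _).
split=> //; move: ws aj; set x := (out_pos j + _)%N.
rewrite {1}/avail => ws aj.
have := ws; case=> bx _.
have [leD|gtD] := leqP (avail (out_pos j) j) (P (j + M.+1) - out_pos j); last first.
  by left; rewrite /x (minn_idPr _); lia.
by right; rewrite (minn_idPl leD) in aj; lia.
Qed.

Lemma writing_out_pos (j : nat) : writing (out_pos j) j.
Proof.
elim: j => [|j IHj]; last by have [ws st] := out_pos_stop _ IHj; apply: writing_next.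
split; first by rewrite P0.
move=> l lel; rewrite /W /=; case: eqP => // l0 ltl.
have l_eq0 : l = 0%N by rewrite -l0 modn_small //; lia.
by rewrite l_eq0 P0 in ltl.
Qed.

Lemma out_pos_mono (i j : nat) : (i <= j)%N -> (out_pos i <= out_pos j)%N.
Proof.
move=> /subnKC <-; elim: (j - i)%N => [|d IHd]; first by rewrite addn0.
by rewrite addnS; apply: leq_trans IHd _; apply: leq_addr.
Qed.

Lemma out_run (j x : nat) : (out_pos j <= x < out_pos j.+1)%N -> o x = (j %% M.+1)%N.
Proof.
have wj := writing_out_pos j; rewrite out_posS // => bx.
by have [_ _ _ ->] := writing_run _ _ _ wj (leqnn _).
Qed.

Definition Dq (j : nat) : nat := avail (out_pos j) j.
Definition Tq (j : nat) : nat := (P (j + M.+1) - out_pos j)%N.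

Lemma out_posS_min (j : nat) : out_pos j.+1 = (out_pos j + minn (Dq j) (Tq j))%N.
Proof. exact/out_posS/writing_out_pos. Qed.

Lemma out_pos_bounds (j : nat) : (P j <= out_pos j <= P (j + M.+1))%N.
Proof. by case: (writing_out_pos j). Qed.

Lemma Tq_rec (j : nat) :
  (Tq j.+1 = Tq j - minn (Dq j) (Tq j) + (P (j.+1 + M.+1) - P (j + M.+1)))%N.
Proof.
have := out_pos_bounds j; have := out_pos_bounds j.+1.
have := @P_mono (j + M.+1)%N (j.+1 + M.+1)%N.
by rewrite /Tq out_posS_min /Tq; lia.
Qed.

(** Between the two positions only the kinds of runs i, ..., j-1 are emitted, and [l] differs from
    all of them modulo M+1. *)
Lemma avail_out_pos (i j l : nat) : (i <= j)%N -> (j <= l <= i + M)%N ->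
  avail (out_pos j) l = avail (out_pos i) l.
Proof.
move=> /subnKC <-; elim: (j - i)%N => [|d IHd] bl; first by rewrite addn0.
rewrite -IHd; last by lia.
have wj := writing_out_pos (i + d).
rewrite addnS out_posS //.
have [_ al _ _] := writing_run _ _ _ wj (leqnn _).
by apply: al; lia.
Qed.

Lemma Dq_init (l : nat) : (l <= M)%N ->
  Dq l = ((if l == 0 then S else 0) + (P l.+1 - P l))%N.
Proof.
move=> lel; rewrite /Dq (@avail_out_pos 0) //; last by lia.
by rewrite /avail /W /= !subn0 modn_small.
Qed.

(** The supply of run j+M+1 can be evaluated already at [out_pos j.+1], since its kind is not
    emitted in between. There input run [j] is fully read, so the carrier holds what output run [j]
    left over, and input run j+M+1 is still unread. *)
Lemma Dq_rec (j : nat) :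
  (Dq (j + M.+1) = Dq j - minn (Dq j) (Tq j) + (P (j + M.+1).+1 - P (j + M.+1)))%N.
Proof.
rewrite {1}/Dq (@avail_out_pos j.+1); [|lia|lia].
rewrite {1}/avail modnDr.
have wj := writing_out_pos j.
have [_ _ aj _] := writing_run _ _ _ wj (leqnn _).
rewrite -out_posS // -/(Tq j) -/(Dq j) in aj.
have := out_pos_bounds j.+1; have := out_pos_bounds j.
have := P_mono _ _ (leqnSn (j + M.+1)); have := out_posS_min j.
by move: aj; rewrite {2}/Tq /avail; lia.
Qed.

Lemma Dq_le (l : nat) : Dq l <= S + P l.+1.
Proof.
elim/ltn_ind: l => l IHl; have P_l := P_mono _ _ (leqnSn l).
have [lel|gtl] := leqP l M.
  by rewrite Dq_init //; case: eqP; lia.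
have -> : l = (l - M.+1) + M.+1 by lia.
rewrite Dq_rec; set l' := l - M.+1.
have := IHl l'; have := @P_mono l'.+1 (l' + M.+1).
have -> : l' + M.+1 = l by rewrite /l'; lia.
by rewrite /l'; lia.
Qed.

Variable j0 : nat.
(* Run [j0+M+1] is the truncation of the infinite empty run behind the last block; it must be long
   enough for the bounds [T] of the last block not to matter. *)
Hypothesis P_big :
  P (j0 + M.+1) + M.+1 * (S + P (j0 + M.+1)) < P (j0 + M.+1).+1.

(** Output run [j0] ends by [P (j0 + M.+1)], and each later run counted here is no longer than its
    supply, bounded by [Dq_le]. *)
Lemma out_pos_tail (k : nat) : k <= M ->
  out_pos (j0 + k.+1) <= P (j0 + M.+1) + k * (S + P (j0 + M.+1)).
Proof.
elim: k => [|k IHk] lek.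
  by have := out_pos_bounds j0; rewrite addn1 out_posS_min /Tq; lia.
rewrite addnS out_posS_min mulSn.
have := IHk (ltnW lek); have := Dq_le (j0 + k.+1).
by have := @P_mono (j0 + k.+1).+1 (j0 + M.+1); lia.
Qed.

Lemma out_pos_last : out_pos (j0 + M.+1) < P (j0 + M.+1).+1.
Proof. by have := out_pos_tail M (leqnn M); move: P_big; rewrite mulSn; lia. Qed.

(** This stands in for the value +oo of the last column: the minimum must be the supply there
    although the truncated lattice has a finite [Tq]. *)
Lemma Dq_le_Tq_last (k : nat) : k < M -> Dq (j0 + k.+1) <= Tq (j0 + k.+1).
Proof.
move=> ltk; have := out_pos_tail k (ltnW ltk).
have := Dq_le (j0 + k.+1); have := @P_mono (j0 + k.+1).+1 (j0 + M.+1).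
have := @P_mono (j0 + M.+1).+1 (j0 + k.+1 + M.+1).
have : k.+1 * (S + P (j0 + M.+1)) <= M.+1 * (S + P (j0 + M.+1)).
  by rewrite leq_mul2r; lia.
by move: P_big; rewrite mulSn /Tq; lia.
Qed.

Hypothesis f_tail : forall x, P (j0 + M.+1) <= x -> f x = 0.
Hypothesis j0_mod : j0 %% M.+1 = 0.

(** By [out_pos_last] this run starts before the final empty input run ends, so [writing] excludes
    all ball kinds from the carrier; afterwards only empty boxes are read. *)
Lemma out_tail (x : nat) : out_pos (j0 + M.+1) <= x -> o x = 0.
Proof.
have o0 y : (forall k, 0 < k <= M -> W y k = 0) -> o y = 0.
  move=> Wy; have := load_emitted_gt0 M S f y S_gt0 f_le; rewrite -/W -/o.
  have := emitted_le M S f y; rewrite -/o.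
  by case: (posnP (o y)) => // oy_gt0 oy_le; rewrite Wy // oy_gt0.
suff W0 d : forall k, 0 < k <= M -> W (out_pos (j0 + M.+1) + d) k = 0.
  by move/subnKC <-; apply/o0/W0.
elim: d => [|d IHd] k bk.
  rewrite addn0; have [_ W0] := writing_out_pos (j0 + M.+1).
  have -> : k = (j0 + M.+1 + k) %% M.+1.
    by rewrite -addnA -modnDml j0_mod add0n modnDl modn_small //; lia.
  apply: W0; first by lia.
  by apply: leq_trans out_pos_last _; apply: P_mono; lia.
have := loadS M S f (out_pos (j0 + M.+1) + d) k S_gt0 f_le.
rewrite [_ + d.+1]addnS -/W IHd // f_tail; first by case: (eqVneq k 0); lia.
by have := out_pos_bounds (j0 + M.+1); lia.
Qed.

Hypothesis P_window : forall l, 0 < l -> l + M <= j0 + M.+1 -> P l < P (l + M).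

(* If the output runs [j, ..., j+M-1] were empty, the runs [j-1, ..., j+M-1] would all end at the
   same position [x].  They comprise all kinds, in particular that of the last box read, which the
   carrier still holds; so the run of that kind was stopped by the next input run of its kind, and
   the [M] input runs in between would be empty. *)
Lemma out_pos_window (j : nat) :
  0 < j -> j + M <= j0 + M.+1 -> out_pos j < out_pos (j + M).
Proof.
move=> j_gt0 lejM; rewrite ltnNge; apply/negP => le_x.
have x_gt0 : 0 < out_pos j.
  apply: leq_trans (out_pos_mono _ _ j_gt0).
  have := P_window 1 isT; rewrite out_posS_min Dq_init //= /Tq /= !add0n subn0 add1n.
  by rewrite leq_min; lia.
have eq_x l : j.-1 <= l < j + M -> out_pos l.+1 = out_pos j.
  by move=> bl; have := @out_pos_mono j l.+1; have := @out_pos_mono l.+1 (j + M); lia.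
case def_x: (out_pos j) x_gt0 => [//|y] _.
have [l bl eql] : exists2 l, j.-1 <= l < j + M & l %% M.+1 = f y %% M.+1.
  have [d bd eqd] := modn_addl_dist M.+1 j.-1 (f y) (ltn0Sn M).
  have [eqdM|ned] := eqVneq d M.+1.
    by exists j.-1; [lia|rewrite -eqd eqdM modnDr].
  by exists (j.-1 + d); [lia|].
have Wl : 0 < W y.+1 (l %% M.+1).
  rewrite eql modn_small; last exact: f_le.
  exact: loadS_gt0.
have [_] := out_pos_stop l (writing_out_pos l).
rewrite eq_x // def_x => -[x_eq|W0]; last by rewrite W0 in Wl.
have [i lti bi] := exists_run P y (l + M.+1) P0 (eq_leq x_eq).
have leK : l + M.+1 <= j0 + M.+1.
  rewrite leqNgt; apply/negP => /P_mono; rewrite -x_eq -def_x.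
  have := out_pos_last; have := @out_pos_mono j (j0 + M.+1); lia.
(* Box [y] has the kind of [l] and lies before run l+M+1, so its run [i] is at most [l]; then runs
   l+1, ..., l+M are squeezed to length 0. *)
have leil : i <= l.
  rewrite leqNgt; apply/negP => ltli.
  by have := mod_neq M l i; rewrite eql (f_run i y bi) modn_mod eqxx; lia.
have := P_window l.+1 isT; have := @P_mono i.+1 l.+1.
by rewrite addSnnS; lia.
Qed.

End Runs.

(** * From the recursion on runs to the Toda lattice *)

Section Toda.

Variables (M S N : nat) (P D T : nat -> nat) (Q : nat -> nat -> int) (E : nat -> xint).
Hypothesis P0 : P 0 = 0%N.
Hypothesis P_mono : forall i j, (i <= j)%N -> (P i <= P j)%N.
Hypothesis D_init : forall l, (l <= M)%N ->
  D l = ((if l == 0 then S else 0) + (P l.+1 - P l))%N.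
Hypothesis T_init : T 0 = P M.+1.
Hypothesis D_rec : forall l,
  (D (l + M.+1) = D l - minn (D l) (T l) + (P (l + M.+1).+1 - P (l + M.+1)))%N.
Hypothesis T_rec : forall l,
  (T l.+1 = T l - minn (D l) (T l) + (P (l.+1 + M.+1) - P (l + M.+1)))%N.
Hypothesis Q_run : forall k n, (0 < k <= M)%N -> (n < N)%N ->
  Q k n = (P (n * M.+1 + k).+1 - P (n * M.+1 + k))%N%:Z.
Hypothesis E_run : forall n, (n.+1 < N)%N ->
  E n = XFin (P (n.+1 * M.+1).+1 - P (n.+1 * M.+1))%N%:Z.
Hypothesis E_last : E N.-1 = XInf.
Hypothesis D_le_T_last : forall k, (0 < k <= M)%N ->
  (D (N.-1 * M.+1 + k) <= T (N.-1 * M.+1 + k))%N.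

Lemma xminE (x y : nat) : xmin (XFin x%:Z) (XFin y%:Z) = XFin (minn x y)%:Z.
Proof. by congr XFin; lia. Qed.

Definition fin_if (b : bool) (x : nat) : xint := if b then XFin x%:Z else XInf.

(** Dictionary: D^(k)_n and Etilde^(k)_n are [D] and [T] at n(M+1)+k, while F_n is [D] at the gap
    run (n+1)(M+1). The loop over k thus becomes consecutive uses of [T_rec], and [fin_if] gives +oo
    in the last column. *)
Lemma Etil_fin (D' : nat -> xint) (n j : nat) :
  (n < N)%N -> (forall k, (0 < k <= M)%N -> D' k = XFin (D (n * M.+1 + k))%:Z) ->
  (j <= M)%N ->
  Etil Q D' (fin_if (n.+1 < N)%N (T (n * M.+1).+1)) n j =
    fin_if (n.+1 < N)%N (T (n * M.+1 + j.+1)).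
Proof.
move=> ltn HD; elim: j => [|j IHj] lej; first by rewrite addn1.
rewrite [LHS]/= IHj ?(ltnW lej) // HD; last by lia.
case: ltnP => lt1 //=.
have -> : (T (n * M.+1 + j.+2) = T (n * M.+1 + j.+1).+1)%N by rewrite -addnS.
rewrite T_rec Q_run //.
have -> : ((n * M.+1 + j.+1).+1 + M.+1 = (n.+1 * M.+1 + j.+1).+1)%N by rewrite mulSn; lia.
have -> : ((n * M.+1 + j.+1) + M.+1 = (n.+1 * M.+1 + j.+1))%N by rewrite mulSn; lia.
by congr XFin; lia.
Qed.

Lemma udhT_state_fin (n : nat) : (n < N)%N ->
  exists D' : nat -> xint,
    (forall k, (0 < k <= M)%N -> D' k = XFin (D (n * M.+1 + k))%:Z) /\
    udhT_state M S Q E n =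
      (D', fin_if (n.+1 < N)%N (D (n.+1 * M.+1)),
           fin_if (n.+1 < N)%N (T (n * M.+1).+1)).
Proof.
have E_fin m : (m < N)%N ->
    E m = fin_if (m.+1 < N)%N (P (m.+1 * M.+1).+1 - P (m.+1 * M.+1)).
  move=> ltm; rewrite /fin_if; case: ltnP => lt1; first exact: E_run.
  by rewrite -E_last; congr E; lia.
elim: n => [|n IHn] ltn.
  exists (fun k => XFin (Q k 0)); split.
    by move=> k bk; rewrite Q_run // D_init; [rewrite mul0n add0n; case: k bk|lia].
  rewrite /udhT_state /= E_fin //.
  have -> : \sum_(1 <= k < M.+1) Q k 0 = (P M.+1)%:Z - (P 1)%:Z.
    rewrite -(telescope_sumr (fun k => (P k)%:Z)) //.
    apply: eq_big_nat => k bk; rewrite Q_run; [|lia|lia].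
    by rewrite mul0n add0n; have := P_mono _ _ (leqnSn k); lia.
  (* Block 0 has [P M.+1 - P 1] balls, and run 0 has supply [S + P 1] and bound [P M.+1]; one step
     of the run recursion from run 0 produces the two maxima of the initial values. *)
  rewrite !mul0n !mul1n; have := D_rec 0; have := T_rec 0; have := P_mono _ _ (leqnSn M.+1).
  rewrite D_init // eqxx T_init P0 !add0n !add1n => leP eT eD.
  have leP1 := @P_mono 1 M.+1 isT.
  by rewrite /fin_if; case: ltnP => // _; congr (_, XFin _, XFin _); lia.
have [D' [HD st]] := IHn (ltnW ltn); rewrite [udhT_state M S Q E n.+1]/= st {st}.
have Et := Etil_fin D' n _ (ltnW ltn) HD.
rewrite ltn /= in Et *.
eexists; split; last first.
  rewrite /= Et // E_fin //.
  congr (_, _, _).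
    rewrite /fin_if; case: ltnP => // _ /=.
    have := D_rec (n.+1 * M.+1).
    have -> : (n.+1 * M.+1 + M.+1 = n.+2 * M.+1)%N by rewrite -mulSnr.
    have -> : (n * M.+1 + M.+1 = n.+1 * M.+1)%N by rewrite -mulSnr.
    by move=> eD; congr XFin; lia.
  rewrite /fin_if; case: ltnP => // _ /=.
  have := T_rec (n.+1 * M.+1); rewrite addSn.
  have -> : (n.+1 * M.+1 + M.+1 = n.+2 * M.+1)%N by rewrite -mulSnr.
  have -> : (n * M.+1 + M.+1 = n.+1 * M.+1)%N by rewrite -mulSnr.
  by move=> eT; congr XFin; lia.
move=> k bk /=; rewrite Et; last by lia.
rewrite HD // Q_run // prednK; last by lia.
rewrite /= ; congr XFin.
have := D_rec (n * M.+1 + k).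
have -> : (n * M.+1 + k + M.+1 = n.+1 * M.+1 + k)%N by rewrite mulSn; lia.
by lia.
Qed.

Lemma udhT_Q_fin (k n : nat) : (0 < k <= M)%N -> (n < N)%N ->
  udhT_Q M S Q E k n =
    XFin (minn (D (n * M.+1 + k)) (T (n * M.+1 + k)))%:Z.
Proof.
move=> bk ltn; rewrite /udhT_Q; have [D' [HD ->]] := udhT_state_fin n ltn.
rewrite Etil_fin //; last by lia.
rewrite HD // prednK; last by lia.
rewrite /fin_if; case: ltnP => ltn1; first by rewrite xminE.
have -> : n = N.-1 by lia.
by rewrite (minn_idPl (D_le_T_last k bk)).
Qed.

Lemma udhT_E_fin (n : nat) : (n.+1 < N)%N ->
  udhT_E M S Q E n = XFin (minn (D (n.+1 * M.+1)) (T (n.+1 * M.+1)))%:Z.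
Proof.
move=> ltn; rewrite /udhT_E; have [D' [HD ->]] := udhT_state_fin n (ltnW ltn).
by rewrite Etil_fin ?(ltnW ltn) // ltn xminE mulSnr.
Qed.

End Toda.

(** * Block structure of the output *)

Lemma modn_block (p n l : nat) : (n * p <= l < n.+1 * p)%N -> (l %% p = l - n * p)%N.
Proof.
rewrite mulSn => bl; have -> : l = (n * p + (l - n * p))%N by lia.
by rewrite modnMDl modn_small; lia.
Qed.

Lemma blk_count_interval (b : int -> nat) (k L U : nat) (lo hi : int) :
  (L <= U <= (absz (hi - lo)).+1)%N ->
  (forall i : nat, (i <= absz (hi - lo))%N -> (b (lo + i%:Z)%R == k) = (L <= i < U)%N) ->
  blk_count b k lo hi = (U - L)%N.
Proof.
move=> bU H; rewrite /blk_count.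
rewrite (eq_big_nat _ _ (F2 := fun i => nat_of_bool (L <= i < U)%N)); last first.
  by move=> i bi; rewrite H //; lia.
have zero m n : (forall i, m <= i < n -> ~~ (L <= i < U))%N ->
    (\sum_(m <= i < n) nat_of_bool (L <= i < U) = 0)%N.
  by move=> nLU; rewrite big_nat big1 // => i /nLU/negbTE->.
rewrite (big_cat_nat (n := L)) //=; last by lia.
rewrite (big_cat_nat (m := L) (n := U)) //=; [|lia|lia].
rewrite (zero 0%N L) ?(zero U) ?addn0 ?add0n; [|by move=> i; lia..].
rewrite (eq_big_nat _ _ (F2 := fun i => 1%N)); last by move=> i ->.
by rewrite sum_nat_const_nat muln1; lia.
Qed.

Section OutputBlocks.

Variables (M N : nat) (g X : nat -> nat) (n0 : int).
Hypothesis M_gt0 : (0 < M)%N.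
Hypothesis X0 : X 0 = 0%N.
Hypothesis X_mono : forall i j, (i <= j)%N -> (X i <= X j)%N.
Hypothesis g_run : forall j x, (X j <= x < X j.+1)%N -> g x = (j %% M.+1)%N.
Hypothesis g_tail : forall x, (X (N * M.+1) <= x)%N -> g x = 0%N.
Hypothesis X_window : forall j, (0 < j)%N -> (j + M <= N * M.+1)%N -> (X j < X (j + M))%N.

Definition out_box (m : int) : nat := if m < n0 then 0%N else g (absz (m - n0)).
Definition out_first (n : nat) : int := n0 + (X (n * M.+1).+1)%:Z.
Definition out_last (n : nat) : int := n0 + (X (n.+1 * M.+1))%:Z - 1.

Lemma out_boxE (x : nat) : out_box (n0 + x%:Z) = g x.
Proof.
rewrite /out_box (_ : (n0 + x%:Z < n0) = false); last by lia.
by congr g; lia.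
Qed.

Lemma out_block_lt (n : nat) : (n < N)%N -> (X (n * M.+1).+1 < X (n.+1 * M.+1))%N.
Proof.
move=> ltn; have -> : (n.+1 * M.+1 = (n * M.+1).+1 + M)%N by rewrite mulSn; lia.
by apply: X_window => //; have := leq_mul2r M.+1 n.+1 N; rewrite ltn orbT mulSn; lia.
Qed.

Lemma block_run (n x : nat) : (X (n * M.+1).+1 <= x < X (n.+1 * M.+1))%N ->
  exists k, [/\ (0 < k <= M)%N, (X (n * M.+1 + k) <= x < X (n * M.+1 + k).+1)%N & g x = k].
Proof.
move=> bx; have [i lti bi] := exists_run X x (n.+1 * M.+1) X0 ltac:(lia).
have gei : ((n * M.+1).+1 <= i)%N by apply: (run_ge X i _ x X_mono); lia.
exists (i - n * M.+1)%N; rewrite subnKC; last by lia.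
split=> //; first by move: lti; rewrite mulSn; lia.
by rewrite (g_run _ _ bi) (modn_block _ n) //; lia.
Qed.

(** The runs strictly between [l] and [l'] are empty, so [X_window] forces l' <= l+M. Passing the
    multiple of M+1 in less than a full period makes the kind drop, unless a box is empty. *)
Lemma out_boundary (q y l l' : nat) :
  (l <= q * M.+1 <= l')%N -> (0 < q)%N -> (l < l' < N * M.+1)%N ->
  (X l <= y < X l.+1)%N -> (X l' <= y.+1 < X l'.+1)%N ->
  g y = 0%N \/ g y.+1 = 0%N \/ (g y.+1 < g y)%N.
Proof.
move=> bq q_gt0 bl by_ by'; rewrite (g_run _ _ by_) (g_run _ _ by').
have le_l' : (l' <= l + M)%N.
  rewrite leqNgt; apply/negP => gtl.
  by have := X_window l.+1 isT; have := X_mono (l.+1 + M)%N l'; lia.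
case: q bq q_gt0 => // q bq _; rewrite mulSn in bq.
have [eql|nel] := eqVneq l (q.+1 * M.+1)%N; first by left; rewrite eql modnMl.
right; right; rewrite (@modn_block _ q.+1 l') ?(@modn_block _ q l) ?mulSn; lia.
Qed.

Lemma out_is_blocks : is_blocks out_box N out_first out_last.
Proof.
have loc n m : out_first n <= m <= out_last n ->
    exists2 x, m = n0 + x%:Z & (X (n * M.+1).+1 <= x < X (n.+1 * M.+1))%N.
  rewrite /out_first /out_last => bm; exists (absz (m - n0)); first by lia.
  by lia.
have ltN n : (n < N)%N -> (n.+1 * M.+1 <= N * M.+1)%N by move=> ?; rewrite leq_mul2r; lia.
(* Maximality on both sides reduces to this: box y+1 is the first of block [n] or the first behind
   block n-1. *)
have edge n y : (0 < n < N)%N -> (y.+1 = X (n * M.+1).+1 \/ y.+1 = X (n * M.+1))%N ->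
    g y = 0%N \/ g y.+1 = 0%N \/ (g y.+1 < g y)%N.
  case: n => // n ltn ey; have := X_mono _ _ (leqnSn (n.+1 * M.+1)).
  have lt1 := @out_block_lt n.+1 ltn; have lt2 := @out_block_lt n (ltnW ltn).
  move=> leX.
  have [le1|gt1] := leqP (X (n.+1 * M.+1)) y.
    left; rewrite (g_run (n.+1 * M.+1)) ?modnMl //; lia.
  have eX : y.+1 = X (n.+1 * M.+1) by lia.
  have [lt|ge] := ltnP y.+1 (X (n.+1 * M.+1).+1).
    by right; left; rewrite (g_run (n.+1 * M.+1)) ?modnMl //; lia.
  have [k [bk ky _]] := @block_run n y ltac:(lia).
  have [k' [bk' ky' _]] := @block_run n.+1 y.+1 ltac:(lia).
  apply: (out_boundary n.+1 y (n * M.+1 + k) (n.+1 * M.+1 + k')) => //.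
    by rewrite mulSn; lia.
  by have := ltN n.+1 ltn; rewrite !mulSn; lia.
split; [|split; [|split; [|split; [|split; [|split]]]]].
- by move=> n /out_block_lt; rewrite /out_first /out_last; lia.
- move=> n ltn; rewrite /out_first /out_last.
  by have := X_mono _ _ (leqnSn (n.+1 * M.+1)); lia.
- move=> n m ltn /loc[x -> bx]; rewrite out_boxE.
  by have [k [bk _ ->]] := block_run _ _ bx; lia.
- move=> n m ltn bm; have [x em bx] : exists2 x, m = n0 + x%:Z &
      (X (n * M.+1).+1 <= x /\ x.+1 < X (n.+1 * M.+1))%N.
    by exists (absz (m - n0)); move: bm; rewrite /out_first /out_last; lia.
  rewrite em -addrA -[x%:Z + 1]/((x + 1)%N%:Z) !out_boxE addn1.
  have [k [bk kx ->]] := @block_run n x ltac:(lia).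
  have [k' [bk' kx' ->]] := @block_run n x.+1 ltac:(lia).
  rewrite leqNgt; apply/negP => ltk.
  by have := X_mono (n * M.+1 + k').+1 (n * M.+1 + k)%N; lia.
- move=> m; rewrite /out_box; case: ltP => // le_m gm.
  have [ltx|gex] := ltnP (absz (m - n0)) (X (N * M.+1)); last by rewrite g_tail in gm.
  have [i lti bi] := exists_run X _ _ X0 ltx.
  rewrite (g_run _ _ bi) in gm.
  have gei := leq_trunc_div i M.+1; have lt_i := ltn_ceil i (ltn0Sn M).
  exists (i %/ M.+1)%N; first by rewrite ltn_divLR.
  have ltdi : ((i %/ M.+1) * M.+1 < i)%N.
    by rewrite [X in (_ < X)%N](divn_eq i M.+1); lia.
  have := X_mono _ _ ltdi; have := X_mono _ _ lt_i.
  by rewrite /out_first /out_last; lia.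
- move=> n ltn; rewrite {2}/out_first out_boxE.
  have gX : g (X (n * M.+1).+1) <> 0%N.
    have := out_block_lt n ltn => lt1.
    by have [k [bk _ ->]] := @block_run n (X (n * M.+1).+1) ltac:(lia); lia.
  (* If the block starts at [n0], the box before it lies left of [n0], where [out_box] is 0. *)
  case eX: (X (n * M.+1).+1) => [|y].
    by rewrite /out_box /out_first eX ifT //; lia.
  have -> : out_first n - 1 = n0 + y%:Z by rewrite /out_first eX; lia.
  rewrite out_boxE; case: n ltn eX gX => [|n] ltn eX gX.
    have by0 : (X 0 <= y < X 1)%N by move: eX; rewrite mul0n X0; lia.
    by rewrite (g_run _ _ by0) mod0n.
  by have := edge n.+1 y ltn ltac:(left; lia); rewrite /= -eX; lia.
- move=> n ltn; have lt1 := out_block_lt n ltn.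
  case eX: (X (n.+1 * M.+1)) => [|y]; first by lia.
  have -> : out_last n + 1 = n0 + y.+1%:Z by rewrite /out_last eX; lia.
  have -> : out_last n = n0 + y%:Z by rewrite /out_last eX; lia.
  rewrite !out_boxE.
  have [k [bk _ gy]] := @block_run n y ltac:(lia).
  have [ltn1|gen1] := ltnP n.+1 N.
    by have := edge n.+1 y ltn1 ltac:(right; lia); rewrite /=; lia.
  by rewrite g_tail // -eX; apply: X_mono; rewrite leq_mul2r; lia.
Qed.

Lemma out_blk_count (k n : nat) : (0 < k <= M)%N -> (n < N)%N ->
  blk_count out_box k (out_first n) (out_last n) =
    (X (n * M.+1 + k).+1 - X (n * M.+1 + k))%N.
Proof.
move=> bk ltn; have lt1 := out_block_lt n ltn.
have le1 := X_mono (n * M.+1).+1 (n * M.+1 + k)%N.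
have le2 := X_mono (n * M.+1 + k).+1 (n.+1 * M.+1)%N.
have le3 := X_mono _ _ (leqnSn (n * M.+1 + k)%N).
have len : (absz (out_last n - out_first n)).+1 = (X (n.+1 * M.+1) - X (n * M.+1).+1)%N.
  by rewrite /out_first /out_last; lia.
rewrite mulSn in le2.
rewrite (@blk_count_interval _ k (X (n * M.+1 + k) - X (n * M.+1).+1)
  (X (n * M.+1 + k).+1 - X (n * M.+1).+1)); first by lia.
  by rewrite len mulSn; lia.
move=> i; rewrite -ltnS len => lti.
rewrite /out_first -addrA -[_%:Z + i%:Z]/((X (n * M.+1).+1 + i)%N%:Z) out_boxE.
have [k' [bk' kx ->]] := @block_run n (X (n * M.+1).+1 + i) ltac:(lia).
apply/eqP/idP => [ek|bi]; first by rewrite ek in kx; lia.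
case: (ltngtP k' k) => // ltk.
  by have := X_mono (n * M.+1 + k').+1 (n * M.+1 + k)%N; lia.
by have := X_mono (n * M.+1 + k).+1 (n * M.+1 + k')%N; lia.
Qed.

End OutputBlocks.

(** * Decomposition of the input blocks into runs *)

Lemma count_lt_sorted (g : nat -> nat) (len k p : nat) :
  (forall i j, (i <= j < len)%N -> (g i <= g j)%N) -> (p < len)%N ->
  (p < count (fun i => g i < k)%N (iota 0 len))%N = (g p < k)%N.
Proof.
elim: len p => [//|len IHlen] p g_sorted ltp.
rewrite -[len.+1]addn1 iotaD count_cat /= add0n addn0.
have le_cnt := count_size (fun i => g i < k)%N (iota 0 len); rewrite size_iota in le_cnt.
have [ltk|gek] := ltnP (g len) k; last first.
  rewrite addn0; have [ltp'|] := ltnP p len.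
    by apply: IHlen => // i j bij; apply: g_sorted; lia.
  move=> gep; have -> : p = len by lia.
  by rewrite [RHS]ltnNge gek ltnNge le_cnt.
have lt_k i : (i <= len)%N -> (g i < k)%N.
  by move=> lei; apply: leq_ltn_trans ltk; apply: g_sorted; lia.
rewrite (@eq_in_count _ _ predT) ?count_predT ?size_iota ?addn1 ?ltp ?lt_k //.
by move=> i; rewrite mem_iota /= => bi; apply: lt_k; lia.
Qed.

Section InputBlocks.

Variables (M N B : nat) (f A C : nat -> nat).

Local Open Scope nat_scope.

Hypothesis M_gt0 : 0 < M.
Hypothesis N_gt0 : 0 < N.
Hypothesis f_le : forall x, f x <= M.
Hypothesis A_lt_C : forall n, n < N -> A n < C n.
Hypothesis C_le_A : forall n, n.+1 < N -> C n <= A n.+1.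
Hypothesis f_gt0 : forall n x, n < N -> A n <= x < C n -> 0 < f x.
Hypothesis f_sorted : forall n x, n < N -> A n <= x < (C n).-1 -> f x <= f x.+1.
Hypothesis f_block : forall x, 0 < f x -> exists2 n, n < N & A n <= x < C n.
Hypothesis f_descent : forall n, n.+1 < N -> C n = A n.+1 -> f (A n.+1) < f (C n).-1.
Hypothesis C_le_B : C N.-1 <= B.

(** Since the block is sorted, this count is also the offset in block [n] at which the balls of kind
    [k] start. *)
Definition below (n k : nat) : nat :=
  count (fun i => f (A n + i) < k) (iota 0 (C n - A n)).

(* Run [n(M+1)+k], for [1 <= k <= M], consists of the balls [k] of block [n]; run [(n+1)(M+1)]
   is the gap after block [n], and run [0] is the gap before block [0].  The last gap, infinite in
   the paper, is cut off at [B]. *)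
Definition run_start (l : nat) : nat :=
  if l is l'.+1 then
    let n := l' %/ M.+1 in
    if n < N then A n + below n (l' %% M.+1).+1 else B
  else 0.

Lemma run_startE (n k : nat) : n < N -> 0 < k <= M.+1 ->
  run_start (n * M.+1 + k) = A n + below n k.
Proof.
case: k => // k ltn bk; rewrite addnS /run_start divnMDl // divn_small //.
by rewrite addn0 ltn modnMDl modn_small.
Qed.

Lemma run_start_end (l : nat) : N * M.+1 < l -> run_start l = B.
Proof.
by case: l => // l; rewrite ltnS /run_start -leq_divRL // leqNgt => /negbTE->.
Qed.

Lemma belowP (n k p : nat) : n < N -> p < C n - A n ->
  (p < below n k) = (f (A n + p) < k).
Proof.
move=> ltn; apply: (count_lt_sorted (fun i => f (A n + i))) => i j /andP[leij].
rewrite -(subnKC leij); elim: (j - i) => [|d IHd] ltj; first by rewrite addn0.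
apply: (@leq_trans (f (A n + (i + d)))); first by apply: IHd; lia.
by rewrite !addnS; apply: (f_sorted n) => //; lia.
Qed.

Lemma below_le (n k : nat) : below n k <= C n - A n.
Proof. by rewrite -[X in _ <= X](size_iota 0); apply: count_size. Qed.

Lemma below_first (n : nat) : n < N -> below n 1 = 0.
Proof.
move=> ltn; apply/eqP; rewrite -leqn0 leqNgt; apply/negP => gt0.
have lt0 : 0 < C n - A n by have := A_lt_C n ltn; lia.
move: gt0; rewrite belowP // addn0 => f0.
by have := f_gt0 n (A n) ltn; have := A_lt_C n ltn; lia.
Qed.

Lemma below_last (n : nat) : below n M.+1 = C n - A n.
Proof.
rewrite /below (@eq_count _ _ predT) ?count_predT ?size_iota // => i.
by rewrite /= ltnS f_le.
Qed.

Lemma below_mono (n k k' : nat) : k <= k' -> below n k <= below n k'.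
Proof. by move=> lek; apply: sub_count => i /= ltk; apply: leq_trans lek. Qed.

Lemma run_start_first (n : nat) : n < N -> run_start (n * M.+1).+1 = A n.
Proof. by move=> ltn; rewrite -addn1 run_startE // below_first // addn0. Qed.

Lemma run_start_gap (n : nat) : n < N -> run_start (n.+1 * M.+1) = C n.
Proof.
move=> ltn; rewrite mulSnr run_startE // ?ltnSn // below_last.
by have := A_lt_C n ltn; lia.
Qed.

Lemma run_index (l : nat) :
  [\/ l = 0, (exists2 n, n < N & exists2 k, 0 < k <= M & l = n * M.+1 + k),
      (exists2 n, n < N & l = n.+1 * M.+1) | N * M.+1 < l].
Proof.
have [->|l_gt0] := posnP l; first by constructor 1.
have [gt|le] := ltnP (N * M.+1) l; first by constructor 4.
have ltm : l %% M.+1 < M.+1 by rewrite ltn_mod.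
have [l0|lk] := posnP (l %% M.+1).
  constructor 3; exists (l %/ M.+1).-1.
    have : l %/ M.+1 <= N by rewrite -ltnS ltn_divLR // mulSn; lia.
    by lia.
  rewrite prednK; last by rewrite divn_gt0 // dvdn_leq // /dvdn l0.
  by rewrite {1}(divn_eq l M.+1) l0 addn0.
constructor 2; exists (l %/ M.+1); last by exists (l %% M.+1); [lia|exact: divn_eq].
rewrite ltn_divLR // ltn_neqAle le andbT.
by apply/eqP => el; rewrite el modnMl in lk.
Qed.

Lemma run_start_leS (l : nat) : run_start l <= run_start l.+1.
Proof.
case: (run_index l) => [->|[n ltn [k bk ->]]|[n ltn ->]|gtl] //.
- by rewrite -addnS !run_startE; [rewrite leq_add2l below_mono|..]; lia.
- rewrite run_start_gap //; have [ltn1|gen1] := ltnP n.+1 N.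
    by rewrite run_start_first // C_le_A.
  rewrite run_start_end; last by rewrite ltnS leq_mul2r; lia.
  by have -> : n = N.-1 by lia.
- by rewrite !run_start_end //; lia.
Qed.

Lemma run_start_mono (i j : nat) : i <= j -> run_start i <= run_start j.
Proof.
move=> /subnKC <-; elim: (j - i) => [|d IHd]; first by rewrite addn0.
by rewrite addnS; apply: leq_trans IHd (run_start_leS _).
Qed.

Lemma f_gap (l x : nat) : l %% M.+1 = 0 -> run_start l <= x < run_start l.+1 -> f x = 0.
Proof.
move=> l0 bx; have [//|/f_block[n ltn bn]] := posnP (f x).
rewrite -run_start_first // -run_start_gap // in bn.
have ltl : n * M.+1 < l.+1.
  rewrite ltnNge; apply/negP => gel.
  by have := run_start_mono l.+1 (n * M.+1).+1; lia.
have ltl' : l < n.+1 * M.+1.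
  by rewrite ltnNge; apply/negP => /run_start_mono; lia.
have el : l = n * M.+1 by have := modn_block M.+1 n l; rewrite l0; lia.
by move: bn bx; rewrite el; lia.
Qed.

Lemma f_run_start (l x : nat) : run_start l <= x < run_start l.+1 -> f x = l %% M.+1.
Proof.
move=> bx; have [l0|] := posnP (l %% M.+1); first by rewrite l0 (f_gap l).
case: (run_index l) => [->|[n ltn [k bk el]]|[n ltn ->]|gtl]; rewrite ?mod0n ?modnMl //; last first.
  by move: bx; rewrite !run_start_end //; lia.
move=> _; rewrite el modnMDl modn_small; last by lia.
move: bx; rewrite el -addnS !run_startE //; [|lia|lia] => bx.
have := below_le n k.+1 => le.
have -> : x = A n + (x - A n) by lia.
by have := belowP n k (x - A n) ltn; have := belowP n k.+1 (x - A n) ltn; lia.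
Qed.

(** If [l] is the first run of a block, the window is that whole nonempty block. Otherwise it
    straddles a gap, and an empty window would mean adjacent blocks with the last ball of one at
    most the first ball of the next, against [f_descent]. *)
Lemma run_start_window (l : nat) : 0 < l -> l + M <= N * M.+1 ->
  run_start l < run_start (l + M).
Proof.
move=> l_gt0 leN.
have [n [ltn [k bk el]]] : exists n, n < N /\ exists2 k, 0 < k <= M.+1 & l = n * M.+1 + k.
  case: (run_index l) => [l0|[n ltn [k bk el]]|[n ltn el]|gtl]; try lia.
    by exists n; split => //; exists k => //; lia.
  by exists n; split => //; exists M.+1; [lia|rewrite el mulSnr].
rewrite el in leN *; case: k bk leN {el} => // -[|k] bk leN.
  have -> : n * M.+1 + 1 + M = n.+1 * M.+1 by rewrite mulSn; lia.
  by rewrite addn1 run_start_first // run_start_gap // A_lt_C.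
have ltn1 : n.+1 < N.
  rewrite -(@ltn_pmul2r M.+1) //; apply: leq_trans leN; rewrite mulSn; lia.
have -> : n * M.+1 + k.+2 + M = n.+1 * M.+1 + k.+1 by rewrite mulSn; lia.
rewrite !run_startE //; last by lia.
have leCA := C_le_A n ltn1; have ltAC := A_lt_C n ltn; have ltAC1 := A_lt_C n.+1 ltn1.
have := below_le n k.+2.
have := belowP n k.+2 (C n - A n).-1 ltn ltac:(lia).
have := belowP n.+1 k.+1 0 ltn1 ltac:(lia).
have -> : A n + (C n - A n).-1 = (C n).-1 by lia.
by rewrite addn0; have := f_descent n ltn1; lia.
Qed.

Lemma run_start_ball (n k p : nat) : n < N -> 0 < k <= M -> p < C n - A n ->
  (f (A n + p) == k) =
  (run_start (n * M.+1 + k) - A n <= p < run_start (n * M.+1 + k).+1 - A n).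
Proof.
move=> ltn bk ltp; rewrite -addnS !run_startE //; [|lia|lia].
by have := belowP n k p ltn ltp; have := belowP n k.+1 p ltn ltp; lia.
Qed.

Lemma run_start_bounds (n k : nat) : n < N -> 0 < k <= M ->
  A n <= run_start (n * M.+1 + k) <= run_start (n * M.+1 + k).+1 /\
  run_start (n * M.+1 + k).+1 <= C n.
Proof.
move=> ltn bk; rewrite -(run_start_gap n) // -(run_start_first n) //.
by split; [apply/andP; split|]; apply: run_start_mono; rewrite ?mulSn; lia.
Qed.

End InputBlocks.

(** * Assembly for the given state *)

Theorem theorem6 (M S : nat) (b : int -> nat) (N : nat) (a c : nat -> int)
  (n0 : int) :
  (1 <= M)%N -> (0 < S)%N ->
  (forall n, (b n <= M)%N) ->
  (1 <= N)%N -> is_blocks b N a c ->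
  (forall n, n < n0 -> b n = 0%N) ->
  let Q := fun k n : nat =>
    if (n < N)%N then (blk_count b k (a n) (c n))%:Z else 0 in
  let E := fun n : nat =>
    if (n.+1 < N)%N then XFin (a n.+1 - c n - 1) else XInf in
  let U' := bbs_next M S b n0 in
  exists (b' : int -> nat) (a' c' : nat -> int),
    (forall n, (b' n <= M)%N) /\
    (forall n k, (k <= M)%N -> U' n k = ((b' n == k)%N : nat)%:Z) /\
    is_blocks b' N a' c' /\
    (forall k n, (1 <= k <= M)%N -> (n < N)%N ->
       udhT_Q M S Q E k n = XFin (blk_count b' k (a' n) (c' n))%:Z) /\
    (forall n, (n.+1 < N)%N -> udhT_E M S Q E n = XFin (a' n.+1 - c' n - 1)).
Proof.
move=> M_gt0 S_gt0 b_le N_gt0 [ac [ca [b_nz [b_sorted [b_block [b_left _]]]]]] b_n0 Q E U'.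
have a_ge n : (n < N)%N -> n0 <= a n.
  move=> ltn; rewrite leNgt; apply/negP => /b_n0.
  by apply: (b_nz n) => //; rewrite lexx ac.
pose f x := b (n0 + x%:Z).
(* Block [n] becomes the half-open interval from [A n] to [C n] in coordinates relative to [n0]. *)
pose A n := absz (a n - n0)%R; pose C n := absz (c n + 1 - n0)%R.
have AE n : (n < N)%N -> a n = n0 + (A n)%:Z by move=> /a_ge; rewrite /A; lia.
have CE n : (n < N)%N -> c n = n0 + (C n)%:Z - 1.
  by move=> ltn; have := a_ge n ltn; have := ac n ltn; rewrite /C; lia.
have f_le x : (f x <= M)%N by apply: b_le.
have A_lt_C n : (n < N)%N -> (A n < C n)%N.
  by move=> ltn; have := ac n ltn; rewrite AE // CE //; lia.
have C_le_A n : (n.+1 < N)%N -> (C n <= A n.+1)%N.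
  by move=> ltn; have := ca n ltn; rewrite AE // CE ?(ltnW ltn) //; lia.
have f_gt0 n x : (n < N)%N -> (A n <= x < C n)%N -> (0 < f x)%N.
  by move=> ltn bx; rewrite lt0n; apply/eqP/(b_nz n) => //; rewrite AE // CE //; lia.
have f_sorted n x : (n < N)%N -> (A n <= x < (C n).-1)%N -> (f x <= f x.+1)%N.
  move=> ltn bx; have -> : f x.+1 = b (n0 + x%:Z + 1) by rewrite /f; congr b; lia.
  by apply: (b_sorted n) => //; rewrite AE // CE //; lia.
have f_block x : (0 < f x)%N -> exists2 n, (n < N)%N & (A n <= x < C n)%N.
  rewrite lt0n => /eqP/b_block[n ltn]; rewrite AE // CE // => bx.
  by exists n => //; lia.
have f_descent n : (n.+1 < N)%N -> C n = A n.+1 -> (f (A n.+1) < f (C n).-1)%N.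
  move=> ltn eCA; have lt1 := A_lt_C n (ltnW ltn).
  have eq_last : f (C n).-1 = b (a n.+1 - 1) by rewrite /f AE //; congr b; lia.
  have := f_gt0 n (C n).-1 (ltnW ltn); rewrite eq_last => last_gt0.
  have /orP[/eqP b0|] := b_left n.+1 ltn; last by rewrite /f -AE.
  by move: last_gt0; rewrite b0; lia.
(* [K] is the end of the last block; the cut-off [B] is the least one allowed by [P_big]. *)
pose K := C N.-1; pose B := (K + M.+1 * (S + K) + 1)%N.
have K_le_B : (K <= B)%N by rewrite /B; lia.
pose P := run_start M N B f A C.
have P0 : P 0 = 0%N by [].
have P_mono := run_start_mono M N B f A C M_gt0 N_gt0 f_le A_lt_C C_le_A f_gt0 f_sorted K_le_B.
have P_run := f_run_start M N B f A C M_gt0 N_gt0 f_le A_lt_C C_le_A f_gt0 f_sorted f_block K_le_B.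
have P_K : P (N * M.+1) = K.
  by rewrite -{1}(prednK N_gt0); apply: run_start_gap => //; lia.
have j0E : (N.-1 * M.+1 + M.+1 = N * M.+1)%N by rewrite -mulSnr prednK.
have P_big : (P (N.-1 * M.+1 + M.+1) + M.+1 * (S + P (N.-1 * M.+1 + M.+1))
    < P (N.-1 * M.+1 + M.+1).+1)%N.
  by rewrite j0E P_K /P run_start_end // /B; lia.
have f_tail x : (P (N.-1 * M.+1 + M.+1) <= x)%N -> f x = 0%N.
  rewrite j0E => lex; have [//|/f_block[n ltn bx]] := posnP (f x).
  have : (P (n.+1 * M.+1) <= P (N * M.+1))%N by apply: P_mono; rewrite leq_mul2r ltn orbT.
  by rewrite {1}/P run_start_gap //; lia.
have P_window l : (0 < l)%N -> (l + M <= N.-1 * M.+1 + M.+1)%N -> (P l < P (l + M))%N.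
  by rewrite j0E => l_gt0 leN; apply: run_start_window.
have j0_mod : (N.-1 * M.+1 %% M.+1 = 0)%N by rewrite modnMl.
pose X := out_pos M S f P; pose g := emitted M S f.
have X0 : X 0 = 0%N by [].
have X_mono : forall i j, (i <= j)%N -> (X i <= X j)%N by apply: out_pos_mono.
have X_run : forall j x, (X j <= x < X j.+1)%N -> g x = (j %% M.+1)%N by apply: out_run.
have X_tail x : (X (N * M.+1) <= x)%N -> g x = 0%N.
  by rewrite -j0E; apply: (out_tail M S f P S_gt0 f_le P0 P_mono P_run (N.-1 * M.+1)).
have X_window j : (0 < j)%N -> (j + M <= N * M.+1)%N -> (X j < X (j + M))%N.
  rewrite -j0E.
  by apply: (out_pos_window M S f P S_gt0 f_le P0 P_mono P_run (N.-1 * M.+1)).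
have D_init := Dq_init M S f P S_gt0 f_le P0 P_mono P_run.
have D_rec := Dq_rec M S f P S_gt0 f_le P0 P_mono P_run.
have T_rec := Tq_rec M S f P S_gt0 f_le P0 P_mono P_run.
have T_init : Tq M S f P 0 = P M.+1 by rewrite /Tq /= subn0.
have X_diff l : (minn (Dq M S f P l) (Tq M S f P l) = X l.+1 - X l)%N.
  by rewrite /X (out_posS_min M S f P S_gt0 f_le P0 P_mono P_run l) addKn.
have Q_run k n : (0 < k <= M)%N -> (n < N)%N ->
    Q k n = (P (n * M.+1 + k).+1 - P (n * M.+1 + k))%N%:Z.
  move=> bk ltn; rewrite /Q ltn; congr Posz.
  have [bA bC] : (A n <= P (n * M.+1 + k) <= P (n * M.+1 + k).+1)%N /\
      (P (n * M.+1 + k).+1 <= C n)%N by apply: run_start_bounds.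
  have lt1 := A_lt_C n ltn.
  have len : (absz (c n - a n)).+1 = (C n - A n)%N by rewrite AE // CE //; lia.
  rewrite (blk_count_interval b k (P (n * M.+1 + k) - A n)%N
    (P (n * M.+1 + k).+1 - A n)%N).
  - by lia.
  - by rewrite len; lia.
  - move=> i; rewrite -ltnS len => lti; rewrite AE // -addrA.
    exact: run_start_ball.
have E_run n : (n.+1 < N)%N ->
    E n = XFin (P (n.+1 * M.+1).+1 - P (n.+1 * M.+1))%N%:Z.
  move=> ltn; have leCA := C_le_A n ltn.
  rewrite /E ltn /P run_start_first // run_start_gap //; last exact: ltnW.
  by congr XFin; rewrite AE // CE ?(ltnW ltn) //; lia.
have E_last : E N.-1 = XInf by rewrite /E prednK // ltnn.
have D_le_T k : (0 < k <= M)%N ->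
    (Dq M S f P (N.-1 * M.+1 + k) <= Tq M S f P (N.-1 * M.+1 + k))%N.
  case: k => // k bk.
  by apply: (Dq_le_Tq_last M S f P S_gt0 f_le P0 P_mono P_run (N.-1 * M.+1) P_big).
exists (out_box g n0), (out_first M X n0), (out_last M X n0).
split; [|split; [|split; [|split]]].
- move=> m; rewrite /out_box; case: ifP => // _; exact: emitted_le.
- move=> m k lek; rewrite /out_box; case: ltP => [lt_m|le_m].
    by rewrite /U' /bbs_next lt_m occ_small // b_n0.
  have {1}-> : m = n0 + (absz (m - n0))%:Z by lia.
  exact: bbs_next_emitted.
- exact: out_is_blocks.
- move=> k n bk ltn.
  rewrite (udhT_Q_fin M S N P (Dq M S f P) (Tq M S f P) Q E) // X_diff.
  by congr (XFin (Posz _)); rewrite (out_blk_count M N).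
- move=> n ltn; rewrite (udhT_E_fin M S N P (Dq M S f P) (Tq M S f P) Q E) // X_diff.
  have := X_mono _ _ (leqnSn (n.+1 * M.+1)).
  by rewrite /out_first /out_last; move=> le; congr XFin; lia.
Qed.
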